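(* Consider an instance of the vehicle routing problem with stochastic demands under the detour-to-depot policy that has the monotonicity property. Let $x^\nu$ be a feasible first-stage solution with set of routes $\mathcal{R}^\nu$ and recourse cost $\mathcal{Q}(x^\nu)=\sum_{r\in\mathcal{R}^\nu}\mathcal{Q}(r)$. Then the set of optimality cuts (P-Cuts) $$\sum_{i\in N(r)}\theta_i\ \ge\ \mathcal{Q}(r)\left(x(p)-|p|+1\right),\qquad r=(0,p,0)\in\mathcal{R}^\nu,$$ is valid, i.e.: (a) every $\theta\in\mathbb{R}_{\ge0}^N$ such that $(x^\nu,\theta)$ satisfies these cuts satisfies $\sum_{i\in N}\theta_i\ge\mathcal{Q}(x^\nu)$; and (b) the cuts never overestimate the recourse of a feasible solution: for every feasible first-stage solution $x^\lambda$ and every collection $\mathcal{C}$ of P-Cuts (associated with routes of feasible first-stage solutions, and possibly including those of $\mathcal{R}^\nu$), $$\min\left\{\sum_{i\in N}\theta_i:\ \theta\in\mathbb{R}_{\ge0}^N,\ (x^\lambda,\theta)\text{ satisfies all cuts of }\mathcal{C}\right\}\ \le\ \mathcal{Q}(x^\lambda).$$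
   Context: Instance: a depot $0$, a finite set of customers $N=\{1,\dots,n\}$, undirected edges between all pairs of distinct elements of $N_0=N\cup\{0\}$ with travel costs $c_{ij}\ge0$, a vehicle capacity $Q>0$, independent non-negative random demands $\xi_i$ ($i\in N$) with finite means $\mu_i$, and a set $M$ of allowed numbers of vehicles. A path is a sequence $p=(i_1,\dots,i_t)$ of distinct customers; the corresponding route is $r=(0,p,0)=(0,i_1,\dots,i_t,0)$. A feasible first-stage solution consists of $m$ routes, for some $m\in M$, such that every customer is visited by exactly one route, exactly once, and on each route the sum of the means $\mu_i$ of its customers is at most $Q$. It is encoded by the vector $x=(x_{ij})$, $x_{ij}$ being the number of times edge $(i,j)$ is traversed (so $x_{ij}\in\{0,1\}$ for edges between customers, $x_{0i}\in\{0,1,2\}$, with $x_{0i}=2$ when $i$ is the only customer of its route). Expected recourse of $p=(i_1,\dots,i_t)$ in the given orientation: $\mathcal{Q}^1(p)=2\sum_{j=1}^t\sum_{l=1}^\infty\mathbb{P}\left(\sum_{k=1}^{j-1}\xi_{i_k}\le lQ<\sum_{k=1}^{j}\xi_{i_k}\right)c_{0i_j}$; $\mathcal{Q}^2(p)$ is the same quantity for the reversed path; $\mathcal{Q}(r)=\mathcal{Q}(p)=\min\{\mathcal{Q}^1(p),\mathcal{Q}^2(p)\}$. The recourse cost of a feasible solution $x$ is $\mathcal{Q}(x)=\sum_r\mathcal{Q}(r)$ over its routes $r$. For a route $r=(0,p,0)$ with $p=(i_1,\dots,i_t)$: $N(r)=\{i_1,\dots,i_t\}$, $|p|=t-1$ is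 the number of edges of $p$, and $x(p)=\sum_{j=1}^{t-1}x_{i_ji_{j+1}}$. The variables $\theta_i\ge0$, $i\in N$, are those of a master problem with objective $\min\sum_{(i,j)}c_{ij}x_{ij}+\sum_{i\in N}\theta_i$, in which $\sum_i\theta_i$ replaces the recourse cost. Monotonicity condition: a set $S\subseteq N$ respects it if for all $a\ne b$ in $S$, all $\tilde S\subseteq S\setminus\{a,b\}$ and all integers $l\ge1$, with $\tilde\xi=\sum_{i\in\tilde S}\xi_i$, $\mathbb{P}(\tilde\xi+\xi_a\le lQ<\tilde\xi+\xi_a+\xi_b)\ge\mathbb{P}(\tilde\xi\le lQ<\tilde\xi+\xi_b)$. Monotonicity property: every $S\subseteq N$ with $\sum_{i\in S}\mu_i\le Q$ respects the monotonicity condition. *)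

(* Defs.v *)
From HB Require Import structures.
From mathcomp Require Import all_boot all_order all_algebra.
From mathcomp Require Import all_classical all_reals all_analysis.

Set Implicit Arguments.
Unset Strict Implicit.
Unset Printing Implicit Defensive.

Import Order.TTheory GRing.Theory Num.Theory.
Import numFieldNormedType.Exports.

Local Open Scope classical_set_scope.
Local Open Scope ring_scope.

(* Customers are 'I_n; the nodes are 'I_n.+1, with the depot at ord0 and
   customer i at lift ord0 i.  A path is a seq of customers. *)

Definition depot (n : nat) : 'I_n.+1 := ord0.

Definition customer (n : nat) (i : 'I_n) : 'I_n.+1 := lift ord0 i.

Definition route (n : nat) (p : seq 'I_n) : seq 'I_n.+1 :=
  depot n :: rcons (map (@customer n) p) (depot n).

Definition steps (V : Type) (s : seq V) : seq (V * V) := zip s (behead s).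

(* Edges are undirected, so a step in either direction counts.  For the
   one-customer route (0, i, 0) both steps traverse the edge (0, i), which
   gives the value 2. *)
Definition traversals (n : nat) (Rs : seq (seq 'I_n)) (i j : 'I_n.+1) : nat :=
  (\sum_(p <- Rs)
     count [pred e | (e == (i, j)) || (e == (j, i))] (steps (route p)))%N.

(* x(p), the sum of x over the edges of the path p (depot edges excluded) *)
Definition path_value (n : nat) (x : 'I_n.+1 -> 'I_n.+1 -> nat)
    (p : seq 'I_n) : nat :=
  (\sum_(e <- steps (map (@customer n) p)) x e.1 e.2)%N.

Section Demands.
Context (R : realType) (n : nat) (d : measure_display) (T : measurableType d)
  (P : probability T R).
Variables (c : 'I_n.+1 -> 'I_n.+1 -> R) (Q : R) (xi : 'I_n -> {RV P >-> R})
  (M : set nat).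

Definition independent_demands : Prop :=
  forall (J : {set 'I_n}) (A : 'I_n -> set R),
    (forall i, measurable (A i)) ->
    P (\bigcap_(i in [set` J]) (xi i @^-1` A i)) =
    (\prod_(i in J) P (xi i @^-1` A i))%E.

Definition load (s : seq 'I_n) (t : T) : R := \sum_(i <- s) xi i t.

Definition set_load (S : {set 'I_n}) (t : T) : R := \sum_(i in S) xi i t.

(* Rs lists the paths of the routes of the solution encoded by x. *)
Definition first_stage_solution (x : 'I_n.+1 -> 'I_n.+1 -> nat)
    (Rs : seq (seq 'I_n)) : Prop :=
  [/\ M (size Rs),
      (forall p, p \in Rs -> p != [::]),
      perm_eq (flatten Rs) (enum 'I_n),
      (forall p, p \in Rs -> (\sum_(i <- p) 'E_P[xi i] <= Q%:E)%E) &
      x =2 traversals Rs].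

(* The series sums probabilities in \bar R.  It is finite as soon as Q > 0 and
   the demands are non-negative and integrable: the number of l >= 1 with
   lQ < X is at most X / Q.  So fine loses nothing under these assumptions.
   With j counted from 0, take j p holds the customers before the j-th one. *)
Definition oriented_recourse (p : seq 'I_n) : R :=
  2 * \sum_(j < size p)
        fine (\sum_(1 <= l <oo)
                P [set t | load (take j p) t <= l%:R * Q
                           < load (take j.+1 p) t]%R)%E
        * c (depot n) (customer (tnth (in_tuple p) j)).

Definition recourse (p : seq 'I_n) : R :=
  Num.min (oriented_recourse p) (oriented_recourse (rev p)).

Definition total_recourse (Rs : seq (seq 'I_n)) : R :=
  \sum_(p <- Rs) recourse p.

Definition p_cut (x : 'I_n.+1 -> 'I_n.+1 -> nat) (theta : 'I_n -> R)
    (p : seq 'I_n) : Prop :=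
  \sum_(i in p) theta i >=
    recourse p * ((path_value x p)%:R - (size p).-1%:R + 1).

Definition monotonicity_condition (S : {set 'I_n}) : Prop :=
  forall (a b : 'I_n), a \in S -> b \in S -> a != b ->
  forall (S' : {set 'I_n}), S' \subset (S :\ a :\ b) ->
  forall l : nat, (1 <= l)%N ->
  (P [set t | set_load S' t + xi a t <= l%:R * Q
              < set_load S' t + xi a t + xi b t]%R >=
   P [set t | set_load S' t <= l%:R * Q < set_load S' t + xi b t]%R)%E.

Definition monotonicity_property : Prop :=
  forall S : {set 'I_n}, (\sum_(i in S) 'E_P[xi i] <= Q%:E)%E ->
    monotonicity_condition S.

Definition cut_feasible (C : set (seq 'I_n))
    (x : 'I_n.+1 -> 'I_n.+1 -> nat) (theta : 'I_n -> R) : Prop :=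
  (forall i, 0 <= theta i) /\ (forall p, C p -> p_cut x theta p).

End Demands.

Definition is_minimum (R : realType) (A : set R) (v : R) : Prop :=
  A v /\ lbound A v.

(* Main.v *)
(* In a cut the factor x(p) - |p| + 1 is positive only if every edge of p is
   used by x; then p, up to reversal, is a contiguous piece of a route of x.
   In (b), take theta_i to be the detour cost of i in the cheaper orientation of
   its route, so that these sum to the recourse of x.  Within such a piece p,
   dropping the customers visited before p can only lower the detour costs, by
   the monotonicity condition applied to one predecessor at a time; hence theta
   satisfies the cut of p.  The minimum is attained because the objective bounds
   every coordinate of theta, which reduces the problem to a compact set. *)

Require Import Defs.
From HB Require Import structures.
From mathcomp Require Import all_boot all_order all_algebra.
From mathcomp Require Import all_classical all_reals all_analysis.
From mathcomp Require Import measurable_realfun.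

Set Implicit Arguments.
Unset Strict Implicit.
Unset Printing Implicit Defensive.

Import Order.TTheory GRing.Theory Num.Theory.
Import numFieldNormedType.Exports.

Local Open Scope classical_set_scope.
Local Open Scope ring_scope.

(** * Contiguous pieces of duplicate-free sequences *)

Lemma uniq_cat_cons_inj (T : eqType) (b : T) (u v u' v' : seq T) :
  uniq (u ++ b :: v) -> u ++ b :: v = u' ++ b :: v' -> u = u' /\ v = v'.
Proof.
move=> uniq_s eq_s.
(* The only occurrence of [b] fixes the length of whatever precedes it, so two splittings at [b] are
   cut at the same place. *)
have index_mid w1 w2 : uniq (w1 ++ b :: w2) -> index b (w1 ++ b :: w2) = size w1.
  rewrite cat_uniq /= negb_or => /and3P[_ /andP[/negbTE b_w1 _] _].
  by rewrite index_cat b_w1 /= eqxx addn0.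
have size_u : size u = size u'.
  by rewrite -(index_mid _ _ uniq_s) eq_s index_mid // -eq_s.
move/eqP: eq_s; rewrite eqseq_cat // => /andP[/eqP-> /eqP[->]].
by split.
Qed.

(** Both pieces pass through the single occurrence of [b] in [r], so they overlap there and can be
    glued. *)
Lemma infix_cons2 (T : eqType) (a b : T) (q r : seq T) :
  uniq r -> infix (b :: q) r -> infix [:: a; b] r -> infix (a :: b :: q) r.
Proof.
move=> uniq_r /infixP[u [v r_uv]] /infixP[u' [v' r_uv']].
have [eq_u eq_v] : u = rcons u' a /\ q ++ v = v'.
  apply: (@uniq_cat_cons_inj _ b); first by rewrite -cat_cons -r_uv.
  by rewrite cat_rcons -cat_cons -r_uv r_uv'.
by apply/infixP; exists u', v; rewrite r_uv eq_u cat_rcons.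
Qed.

(** The successor of [b] in [r] is [a], so a nonempty [q] would have to begin with [a]. *)
Lemma infix2_tail_nil (T : eqType) (a b : T) (q r : seq T) :
  uniq r -> infix (b :: q) r -> infix [:: b; a] r -> a \notin q -> q = [::].
Proof.
move=> uniq_r /infixP[u [v r_uv]] /infixP[u' [v' r_uv']].
have [_ eq_v] : u = u' /\ q ++ v = a :: v'.
  apply: (@uniq_cat_cons_inj _ b); first by rewrite -cat_cons -r_uv.
  by rewrite -cat_cons -r_uv r_uv'.
by case: q eq_v {r_uv} => //= x q [-> _]; rewrite inE eqxx.
Qed.

(** This lets a piece of a route grow by one customer at its front when the new edge is known only
    without direction. If [r] goes from [a] to [b], the pieces glue. If it goes from [b] to [a],
    then [q] is empty and the two-customer path is read backwards. *)
Lemma infix_cons_adjacent (T : eqType) (a b : T) (q r : seq T) :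
    uniq r -> uniq (a :: b :: q) ->
    infix (b :: q) r || infix (b :: q) (rev r) ->
    infix [:: a; b] r || infix [:: b; a] r ->
  infix (a :: b :: q) r || infix (a :: b :: q) (rev r).
Proof.
(* Hypotheses and conclusion are invariant under reversing [r]. *)
wlog: r / infix (b :: q) r => [wlog_r uniq_r uniq_p inf adj|].
  case/orP: (inf) => [inf_r|inf_r]; first exact: wlog_r.
  rewrite orbC -{2}(revK r); apply: wlog_r => //; rewrite ?rev_uniq //.
    by rewrite inf_r.
  by rewrite -2!infix_revLR orbC.
move=> inf_r uniq_r uniq_p _ /orP[ab|ba]; first by rewrite infix_cons2.
have q0 : q = [::].
  apply: infix2_tail_nil inf_r ba _ => //.
  by move: uniq_p => /= /andP[]; rewrite inE negb_or => /andP[].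
by rewrite q0 -infix_revLR ba orbT.
Qed.

Lemma flatten_uniq_eq (T : eqType) (Rs : seq (seq T)) (b : T) (r r' : seq T) :
  uniq (flatten Rs) -> r \in Rs -> r' \in Rs -> b \in r -> b \in r' -> r = r'.
Proof.
elim: Rs => //= s Rs IH; rewrite cat_uniq => /and3P[_ /hasPn sRs uniq_Rs].
have disj t : t \in Rs -> b \in t -> b \notin s.
  by move=> t_Rs b_t; apply: sRs; apply/flattenP; exists t.
rewrite !inE => /orP[/eqP->|r_Rs] /orP[/eqP->|r'_Rs] // b_r b_r'.
- by have := disj _ r'_Rs b_r'; rewrite b_r.
- by have := disj _ r_Rs b_r; rewrite b_r'.
- exact: IH.
Qed.

Lemma flatten_uniq_mem (T : eqType) (Rs : seq (seq T)) (r : seq T) :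
  uniq (flatten Rs) -> r \in Rs -> uniq r.
Proof.
elim: Rs => //= s Rs IH; rewrite cat_uniq => /and3P[uniq_s _ uniq_Rs].
by rewrite inE => /orP[/eqP->|/(IH uniq_Rs)].
Qed.

(** * Steps of a sequence and traversal counts of undirected edges *)

Lemma mem_steps (T : eqType) (s : seq T) (a b : T) :
  ((a, b) \in steps s) = infix [:: a; b] s.
Proof.
elim: s => [|x [|y s] IH] //.
  by rewrite in_nil /=; case: eqP.
have -> : steps (x :: y :: s) = (x, y) :: steps (y :: s) by [].
by rewrite inE IH /= xpair_eqE prefix0s andbT.
Qed.

Lemma size_steps (T : Type) (s : seq T) : size (steps s) = (size s).-1.
Proof. by rewrite size_zip size_behead; case: s => //= x s; apply/minn_idPr. Qed.

Lemma steps_map (T T' : Type) (f : T -> T') (s : seq T) :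
  steps (map f s) = [seq (f e.1, f e.2) | e <- steps s].
Proof. by elim: s => [|x [|y s] IH] //; rewrite /steps /=; congr cons. Qed.

Definition joins (T : eqType) (i j : T) : pred (T * T) :=
  [pred e | (e == (i, j)) || (e == (j, i))].

Lemma count_joins_cons (T : eqType) (i j x : T) (s : seq T) :
  x != i -> x != j ->
  count (joins i j) (steps (x :: s)) = count (joins i j) (steps s).
Proof.
move=> /negbTE x_i /negbTE x_j; case: s => [|y s] //.
have -> : steps (x :: y :: s) = (x, y) :: steps (y :: s) by [].
by rewrite /joins /= !xpair_eqE x_i x_j.
Qed.

Lemma count_joins_rcons (T : eqType) (i j x : T) (s : seq T) :
  x != i -> x != j ->
  count (joins i j) (steps (rcons s x)) = count (joins i j) (steps s).
Proof.
move=> /negbTE x_i /negbTE x_j; elim: s => [|y [|z s] IH] //.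
  by rewrite /joins /= !xpair_eqE x_i x_j !andbF.
rewrite [steps (rcons _ _)](_ : _ = (y, z) :: steps (rcons (z :: s) x)) //.
by rewrite [steps (y :: _)](_ : _ = (y, z) :: steps (z :: s)) //= IH.
Qed.

Lemma count_joins_notin (T : eqType) (i j : T) (s : seq T) :
  i \notin s -> count (joins i j) (steps s) = 0%N.
Proof.
move=> i_s; apply/eqP; rewrite -leqn0 leqNgt -has_count.
apply/hasPn => -[a b]; rewrite mem_steps => /mem_infix ab_s; rewrite /joins /=.
rewrite !xpair_eqE; apply/negP => /orP[|] /andP[/eqP ea /eqP eb];
  move: i_s; rewrite ab_s ?ea ?eb //= !inE eqxx ?orbT //.
Qed.

(** If the head of [s] is [i] or [j], it does not recur, so only the first step can join the two;
    otherwise the first step does not count and induction applies. *)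
Lemma count_joins_le1 (T : eqType) (i j : T) (s : seq T) :
  uniq s -> (count (joins i j) (steps s) <= 1)%N.
Proof.
elim: s => [|x [|y s] IH] // /andP[x_s uniq_s].
rewrite [steps _](_ : _ = (x, y) :: steps (y :: s)) // [count _ _]/=.
rewrite {1}/joins /= !xpair_eqE; case: (x =P i) => [<-|_] /=.
  rewrite count_joins_notin // addn0; exact: leq_b1.
case: (x =P j) => [<-|_] /=; last exact: IH.
rewrite (@eq_count _ (joins i x) (joins x i)) ?count_joins_notin //.
  by rewrite addn0 leq_b1.
by move=> e; rewrite /joins /= orbC.
Qed.

Lemma customer_inj (n : nat) : injective (@customer n).
Proof. exact: lift_inj. Qed.

Lemma traversals_customer (n : nat) (Rs : seq (seq 'I_n)) (i j : 'I_n) :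
  traversals Rs (customer i) (customer j) =
  (\sum_(p <- Rs) count (joins i j) (steps p))%N.
Proof.
apply: eq_bigr => p _.
rewrite -[LHS]/(count (joins (customer i) (customer j)) _) /route.
rewrite -rcons_cons count_joins_rcons ?count_joins_cons //.
rewrite steps_map count_map; apply: eq_count => e.
by rewrite /joins /= !xpair_eqE !(inj_eq (@customer_inj n)).
Qed.

(** Only the route containing [i] can contribute. The bound concerns edges between customers: a
    one-customer route traverses its depot edge twice. *)
Lemma traversals_le1 (n : nat) (Rs : seq (seq 'I_n)) (i j : 'I_n) :
  uniq (flatten Rs) -> (traversals Rs (customer i) (customer j) <= 1)%N.
Proof.
rewrite traversals_customer; elim: Rs => [|p Rs IH]; first by rewrite big_nil.
rewrite big_cons /= cat_uniq => /and3P[uniq_p /hasPn disj uniq_Rs].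
have [i_p|i_p] := boolP (i \in p); last by rewrite count_joins_notin ?IH.
rewrite big1_seq ?addn0 ?count_joins_le1 // => q /= q_Rs.
apply: count_joins_notin; apply: contraL i_p => i_q; apply: disj.
by apply/flattenP; exists q.
Qed.

Lemma traversals_gt0 (n : nat) (Rs : seq (seq 'I_n)) (i j : 'I_n) :
  reflect
    (exists2 r, r \in Rs & infix [:: i; j] r || infix [:: j; i] r)
    (0 < traversals Rs (customer i) (customer j))%N.
Proof.
rewrite traversals_customer lt0n sum_nat_seq_neq0.
have joinsE r : (count (joins i j) (steps r) != 0%N) =
    infix [:: i; j] r || infix [:: j; i] r.
  rewrite -lt0n -has_count -!mem_steps; apply/hasP/orP.
    move=> [e e_r]; rewrite /joins /=.
    by case/orP => /eqP ee; rewrite -ee; [left|right].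
  by case=> e_r; eexists; eauto; rewrite /joins /= eqxx ?orbT.
apply: (iffP hasP) => -[r r_Rs]; rewrite /= ?joinsE => H; exists r => //=.
by rewrite joinsE.
Qed.

(** * Paths all of whose edges are used by a solution *)

Lemma sum_le1_all_gt0 (T : eqType) (f : T -> nat) (s : seq T) :
  (forall e, f e <= 1)%N -> (size s <= \sum_(e <- s) f e)%N ->
  forall e, e \in s -> (0 < f e)%N.
Proof.
move=> f_le1; elim: s => //= x s IH; rewrite big_cons => le_sum.
have le_s : (\sum_(e <- s) f e <= size s)%N.
  by rewrite -sum1_size; apply: leq_sum.
(* A zero at the head would leave the tail to sum to more than its size. *)
have fx_gt0 : (0 < f x)%N.
  rewrite lt0n; apply/eqP => fx0; move: le_sum.
  by rewrite fx0 add0n leqNgt ltnS le_s.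
have IHs : forall e, e \in s -> (0 < f e)%N.
  apply: IH; move: le_sum; rewrite -add1n.
  by move=> /leq_trans/(_ (leq_add (f_le1 x) (leqnn _))); rewrite leq_add2l.
by move=> e; rewrite inE => /orP[/eqP->|/IHs].
Qed.

Lemma path_valueE (n : nat) (x : 'I_n.+1 -> 'I_n.+1 -> nat) (p : seq 'I_n) :
  path_value x p = (\sum_(e <- steps p) x (customer e.1) (customer e.2))%N.
Proof. by rewrite /path_value steps_map big_map. Qed.

Lemma path_value_full (n : nat) (Rs : seq (seq 'I_n)) (p : seq 'I_n) :
  p \in Rs -> ((size p).-1 <= path_value (traversals Rs) p)%N.
Proof.
move=> p_Rs; rewrite path_valueE -size_steps -sum1_size big_seq [leqRHS]big_seq.
apply: leq_sum => -[i j]; rewrite mem_steps => ij.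
by apply/traversals_gt0; exists p; rewrite //= ij.
Qed.

(** Each edge has value at most 1, so a full path value forces every edge of [p] to be used.
    Induction from the front of [p] then works inside one route: the route of the tail and the route
    using the first edge share the customer [b], hence coincide. *)
Lemma path_value_subpath (n : nat) (Rs : seq (seq 'I_n)) (p : seq 'I_n) :
    uniq (flatten Rs) -> (forall i, i \in flatten Rs) ->
    uniq p -> p != [::] -> ((size p).-1 <= path_value (traversals Rs) p)%N ->
  exists2 r, r \in Rs & infix p r || infix p (rev r).
Proof.
move=> uniq_Rs all_Rs uniq_p p_neq0; rewrite path_valueE -size_steps.
move=> /sum_le1_all_gt0 => /(_ (fun e => traversals_le1 _ _ uniq_Rs)).
elim: p uniq_p p_neq0 => // a [|b q] IH uniq_p _ adj.
  have /flattenP[r r_Rs a_r] := all_Rs a.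
  by exists r; rewrite // !infix1s a_r.
have stepsE : steps (a :: b :: q) = (a, b) :: steps (b :: q) by [].
have [|||r r_Rs inf_r] := IH; rewrite //; first by case/andP: uniq_p.
  by move=> e e_q; apply: adj; rewrite stepsE inE e_q orbT.
have /= := adj (a, b); rewrite stepsE mem_head => /(_ isT)/traversals_gt0[r'].
move=> r'_Rs adj_r'.
have b_r : b \in r.
  by case/orP: inf_r => /mem_infix/(_ b (mem_head _ _)); rewrite ?mem_rev.
have b_r' : b \in r'.
  by case/orP: adj_r' => /mem_infix; apply; rewrite !inE eqxx ?orbT.
have eq_r := flatten_uniq_eq uniq_Rs r_Rs r'_Rs b_r b_r'.
exists r => //; apply: infix_cons_adjacent => //.
  exact: flatten_uniq_mem r_Rs.
by rewrite eq_r.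
Qed.

(** * Expected detour costs and their behaviour under added predecessors *)

Section DetourCosts.
Context (R : realType) (n : nat) (d : measure_display) (T : measurableType d)
  (P : probability T R) (c : 'I_n.+1 -> 'I_n.+1 -> R) (Q : R)
  (xi : 'I_n -> {RV P >-> R}).
Hypotheses (c_ge0 : forall i j, i != j -> 0 <= c i j) (Q_gt0 : 0 < Q)
  (xi_ge0 : forall i t, 0 <= xi i t)
  (xi_mean : forall i, P.-integrable setT (EFin \o xi i)).

Definition failure_event (s : seq 'I_n) (i : 'I_n) (l : nat) : set T :=
  [set t | load xi s t <= l%:R * Q < load xi (rcons s i) t].

Definition failures (s : seq 'I_n) (i : 'I_n) : \bar R :=
  (\sum_(1 <= l <oo) P (failure_event s i l))%E.

Definition detour_cost (s : seq 'I_n) (i : 'I_n) : R :=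
  2 * (fine (failures s i) * c (depot n) (customer i)).

Lemma load_rcons (s : seq 'I_n) (i : 'I_n) (t : T) :
  load xi (rcons s i) t = load xi s t + xi i t.
Proof. by rewrite /load -cats1 big_cat big_seq1. Qed.

Lemma load_ge0 (s : seq 'I_n) (t : T) : 0 <= load xi s t.
Proof. by apply: sumr_ge0. Qed.

Lemma measurable_load (s : seq 'I_n) : measurable_fun setT (load xi s).
Proof. by apply: measurable_sum => i; exact: measurable_funPT. Qed.

Lemma measurable_load_gt (s : seq 'I_n) (r : R) :
  measurable [set t | r < load xi s t].
Proof.
rewrite (_ : [set t | _] = setT `&` load xi s @^-1` `]r, +oo[).
  by apply: measurable_load => //; exact: measurable_itv.
by rewrite setTI; apply/seteqP; split=> t; rewrite /= in_itv /= andbT.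
Qed.

Lemma measurable_failure_event (s : seq 'I_n) (i : 'I_n) (l : nat) :
  measurable (failure_event s i l).
Proof.
rewrite (_ : failure_event s i l = [set t | l%:R * Q < load xi (rcons s i) t]
                                   `\` [set t | l%:R * Q < load xi s t]).
  by apply: measurableD; exact: measurable_load_gt.
apply/seteqP; split=> t; rewrite /failure_event /= leNgt.
  by move=> /andP[/negP].
by move=> [-> /negP ->].
Qed.

(** Pointwise form of the fact that at most [load / Q] positive multiples of [Q] lie below the load;
    integrating it bounds the expected number of failures. *)
Lemma sum_indic_le (s : seq 'I_n) (N : nat) (t : T) :
  \sum_(1 <= l < N.+1) Q * \1_[set t | l%:R * Q < load xi s t] t <= load xi s t.
Proof.
elim: N => [|N IH]; first by rewrite big_nil load_ge0.
(* Either the load exceeds [N.+1] times [Q], and bounding every indicator by 1 suffices, or the last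
   indicator vanishes and induction applies. *)
have [lt_load|le_load] := ltP (N.+1%:R * Q) (load xi s t).
  apply: (le_trans _ (ltW lt_load)).
  rewrite -[N.+1 in leRHS]subn0 -[(_ - 0)%N]/(N.+2 - 1)%N -mulr_natl mulr1.
  rewrite mulr_natl -sumr_const_nat; apply: ler_sum => l _.
  by rewrite -[leRHS]mulr1 ler_pM2l // indicE lern1 leq_b1.
rewrite big_nat_recr //= indicE memNset ?mulr0 ?addr0 //=.
by apply/negP; rewrite -leNgt.
Qed.

(* Without finiteness, fine would send an infinite series to 0 and inequalities
   between failures would not pass to detour_cost. *)
Lemma failures_lty (s : seq 'I_n) (i : 'I_n) : (failures s i < +oo)%E.
Proof.
have int_load : P.-integrable setT (EFin \o load xi (rcons s i)).
  rewrite (_ : _ \o _ = fun t => (\sum_(j <- rcons s i) (xi j t)%:E)%E).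
    by apply: integrable_sum => // j _; exact: xi_mean.
  by apply/funext => t /=; rewrite /load sumEFin.
set X := load xi (rcons s i) in int_load *.
pose B l := [set t | l%:R * Q < X t].
have mB l : measurable (B l) by exact: measurable_load_gt.
have fin_int : (\int[P]_t (X t)%:E < +oo)%E by exact: integrable_lty int_load.
have Q_ge0 := ltW Q_gt0.
have Qinv_ge0 : (0 <= Q^-1%:E)%E by rewrite lee_fin invr_ge0.
have int_ge0 : (0 <= \int[P]_t (X t)%:E)%E.
  by apply: integral_ge0 => t _; rewrite lee_fin load_ge0.
(* A failure at level [l] implies [B l], so the partial sums of [Q * P (B l)], bounded by the mean
   of [X], control those of the series. *)
suff /le_lt_trans : (failures s i <= Q^-1%:E * \int[P]_t (X t)%:E)%E.
  by apply; exact: lte_mul_pinfty.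
apply: lime_le; first exact: is_cvg_nneseries.
apply: nearW => -[|N]; first by rewrite big_geq // mule_ge0.
rewrite lee_pdivlMl //.
apply: (@le_trans _ _ (\sum_(1 <= l < N.+1) Q%:E * P (B l))%E).
  rewrite ge0_sume_distrr //; apply: lee_sum => l _.
  rewrite lee_wpmul2l ?lee_fin // le_measure ?inE //.
    exact: measurable_failure_event.
  by move=> t /= /andP[].
apply: (@le_trans _ _ (\sum_(1 <= l < N.+1) \int[P]_t (Q * \1_(B l) t)%:E)%E).
  apply: lee_sum => l _; under eq_integral do rewrite EFinM.
  rewrite ge0_integralZl ?lee_fin //.
    by rewrite integral_indic // setIT.
  by apply/measurable_EFinP; exact: measurable_indic.
have m_ind l : measurable_fun setT (fun t => (Q * \1_(B l) t)%:E).
  apply/measurable_EFinP; apply: measurable_funM => //; exact: measurable_indic.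
have ge0_ind l t : (0 <= (Q * \1_(B l) t)%:E)%E.
  by rewrite lee_fin mulr_ge0.
rewrite -ge0_integral_sum //; apply: ge0_le_integral => //.
- by move=> t _; apply: sume_ge0.
- exact: emeasurable_sum.
- by apply/measurable_EFinP; exact: measurable_load.
- by move=> t _; rewrite sumEFin lee_fin; exact: sum_indic_le.
Qed.

Lemma failures_ge0 (s : seq 'I_n) (i : 'I_n) : (0 <= failures s i)%E.
Proof. exact: nneseries_ge0. Qed.

Lemma detour_cost_ge0 (s : seq 'I_n) (i : 'I_n) : 0 <= detour_cost s i.
Proof.
by rewrite /detour_cost !mulr_ge0 // ?fine_ge0 ?failures_ge0 ?c_ge0.
Qed.

Lemma set_load_seq (s : seq 'I_n) (t : T) :
  uniq s -> set_load xi [set i in s]%SET t = load xi s t.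
Proof.
move=> uniq_s; rewrite /set_load /load big_uniq //.
by apply: eq_bigl => i; rewrite inE.
Qed.

(** The monotonicity condition, applied for each level [l] with the set of [s] as [S'] and [i] in
    the role of [b], compares the two series term by term. *)
Lemma failures_cons (S : {set 'I_n}) (a : 'I_n) (s : seq 'I_n) (i : 'I_n) :
    monotonicity_condition Q xi S -> {subset a :: rcons s i <= S} ->
    uniq (a :: rcons s i) ->
  (failures s i <= failures (a :: s) i)%E.
Proof.
move=> mono_S sub_S; rewrite /= mem_rcons inE rcons_uniq negb_or.
move=> /andP[/andP[a_i a_s] /andP[i_s uniq_s]].
(* Turning the lower summation bound into a condition makes [1 <= l] available for each term, as the
   monotonicity condition requires. *)
rewrite /failures eseries_cond [leRHS]eseries_cond.
apply: lee_nneseries => // l /= l_ge1.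
rewrite (_ : failure_event s i l = [set t | set_load xi [set j in s]%SET t
    <= l%:R * Q < set_load xi [set j in s]%SET t + xi i t]); last first.
  by apply/seteqP; split=> t; rewrite /failure_event /= load_rcons set_load_seq.
rewrite (_ : failure_event (a :: s) i l = [set t |
    set_load xi [set j in s]%SET t + xi a t <= l%:R * Q
    < set_load xi [set j in s]%SET t + xi a t + xi i t]); last first.
  by apply/seteqP; split=> t;
    rewrite /failure_event /mkset load_rcons set_load_seq // /load big_cons
            [xi a t + _]addrC.
apply: mono_S => //; first by apply: sub_S; rewrite mem_head.
  by apply: sub_S; rewrite inE mem_rcons mem_head orbT.
apply/fintype.subsetP => j; rewrite !inE => j_s.
rewrite sub_S ?andbT; last by rewrite inE mem_rcons inE j_s !orbT.
by apply/andP; split; apply: contraTneq j_s => ->.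
Qed.

Lemma failures_cat (S : {set 'I_n}) (u s : seq 'I_n) (i : 'I_n) :
    monotonicity_condition Q xi S -> {subset u ++ rcons s i <= S} ->
    uniq (u ++ rcons s i) ->
  (failures s i <= failures (u ++ s) i)%E.
Proof.
move=> mono_S; elim: u => //= a u IH sub_S /andP[a_us uniq_us].
apply: (le_trans (IH _ uniq_us)) => [j j_us|].
  by apply: sub_S; rewrite inE j_us orbT.
by apply: (failures_cons mono_S); rewrite rcons_cat //= a_us.
Qed.

(** Indexing by customers instead of positions allows comparison with a longer path, where the same
    customer sits at another position. *)
Lemma oriented_recourseE (p : seq 'I_n) : uniq p ->
  oriented_recourse c Q xi p =
  \sum_(i <- p) detour_cost (take (index i p) p) i.
Proof.
move=> uniq_p; rewrite /oriented_recourse /detour_cost -mulr_sumr; congr (_ * _).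
rewrite (big_tnth _ _ p); apply: eq_bigr => j _.
have eq_nth : tnth (in_tuple p) j = nth (tnth (in_tuple p) j) p j.
  exact: tnth_nth.
have -> : index (tnth (in_tuple p) j) p = j.
  by rewrite eq_nth index_uniq.
congr (fine _ * _); rewrite /failures /failure_event.
by rewrite eq_nth -take_nth.
Qed.

Lemma recourse_ge0 (p : seq 'I_n) : 0 <= recourse c Q xi p.
Proof.
have oriented_ge0 q : 0 <= oriented_recourse c Q xi q.
  rewrite mulr_ge0 // sumr_ge0 // => j _.
  by rewrite mulr_ge0 // ?c_ge0 // fine_ge0 // nneseries_ge0.
by rewrite /recourse le_min !oriented_ge0.
Qed.

Lemma recourse_rev (p : seq 'I_n) :
  recourse c Q xi (rev p) = recourse c Q xi p.
Proof. by rewrite /recourse revK minC. Qed.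

(** With [r = u ++ p ++ v], the customers before [i] in [r] are [u] followed by those before [i] in
    [p]; [failures_cat] accounts for [u]. *)
Lemma oriented_recourse_infix (p r : seq 'I_n) :
    monotonicity_condition Q xi [set i in r]%SET -> uniq r -> infix p r ->
  oriented_recourse c Q xi p <= \sum_(i <- p) detour_cost (take (index i r) r) i.
Proof.
move=> mono_r uniq_r p_r; rewrite oriented_recourseE ?(infix_uniq p_r) //.
have /infixP[u [v r_upv]] := p_r.
rewrite big_seq [leRHS]big_seq; apply: ler_sum => i i_p.
have prefix_i : uniq (u ++ p) -> take (index i r) r = u ++ take (index i p) p.
  rewrite cat_uniq => /and3P[_ /hasPn/(_ _ i_p)/negbTE /= i_u _].
  rewrite r_upv index_cat i_u index_cat i_p take_cat ltnNge leq_addr /=.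
  by rewrite addKn takel_cat // index_size.
have uniq_up : uniq (u ++ p).
  by move: uniq_r; rewrite r_upv catA cat_uniq => /andP[].
rewrite prefix_i // /detour_cost ler_pM2l // ler_wpM2r ?c_ge0 //.
have rconsE : rcons (take (index i p) p) i = take (index i p).+1 p.
  by rewrite (take_nth i) ?index_mem // nth_index.
apply: fine_le; rewrite ?fin_num_abs ?gee0_abs ?failures_ge0 ?failures_lty //.
apply: (failures_cat mono_r); rewrite rconsE.
  move=> j; rewrite mem_cat inE r_upv !mem_cat => /orP[->//|/mem_take->].
  by rewrite orbT.
by apply: subseq_uniq uniq_up; rewrite cat_subseq // take_subseq.
Qed.

End DetourCosts.

(** * Attainment of the minimum of a covering problem *)

Lemma covering_minimum (R : realType) (n : nat) (I : Type) (C : set I)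
    (J : I -> {pred 'I_n}) (b : I -> R) (theta0 : 'I_n -> R) :
  let K := [set theta : 'I_n -> R | (forall i, 0 <= theta i) /\
              forall p, C p -> b p <= \sum_(i in J p) theta i] in
  K theta0 ->
  exists v, is_minimum [set \sum_i theta i | theta in K] v
            /\ v <= \sum_i theta0 i.
Proof.
move=> K K0; pose B := \sum_i theta0 i.
pose cube := [set v : 'rV[R]_n | forall i, `[0, B]%classic (v ord0 i)].
(* [C] may be infinite; an arbitrary intersection of closed half-spaces is still closed. *)
pose cuts := \bigcap_(p in C)
  (fun v : 'rV[R]_n => \sum_(i in J p) v ord0 i) @^-1` [set y | b p <= y].
have cont_sum (Jp : {pred 'I_n}) :
    continuous (fun v : 'rV[R]_n => \sum_(i in Jp) v ord0 i).
  apply: continuous_big => [|i _]; first exact: add_continuous.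
  exact: coord_continuous.
have cpt : compact (cuts `&` cube).
  rewrite setIC; apply: compact_closedI.
    by apply: (@rV_compact R n (fun=> `[0, B]%classic)) => i; exact: segment_compact.
  apply: closed_bigI => p _; apply: preimage_closed; last exact: closed_ge.
  by move=> v _; exact: cont_sum.
have KcubeP theta : K theta -> \sum_i theta i <= B ->
    (cuts `&` cube) (\row_i theta i).
  move=> [theta_ge0 theta_C] le_B; split=> [p Cp|i] /=.
    by under eq_bigr do rewrite mxE; exact: theta_C.
  rewrite mxE in_itv /= theta_ge0 /= (le_trans _ le_B) // (bigD1 i) //= lerDl.
  exact: sumr_ge0.
have sum_row theta : \sum_i (\row_j theta j : 'rV[R]_n) ord0 i = \sum_i theta i.
  by apply: eq_bigr => i _; rewrite mxE.
have in0 := KcubeP _ K0 (lexx _).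
have [v /set_mem[v_cuts v_cube] v_min] := EVT_min_rV (ex_intro _ _ in0) cpt
  (continuous_subspaceT (cont_sum predT)).
have v_le theta : K theta -> \sum_i theta i <= B ->
    \sum_i v ord0 i <= \sum_i theta i.
  move=> K_theta le_B; rewrite -(sum_row theta); apply: v_min.
  by apply/mem_set; exact: KcubeP.
have v_le0 : \sum_i v ord0 i <= B by exact: v_le.
exists (\sum_i v ord0 i); split=> //; split.
  exists (fun i => v ord0 i) => //; split=> [i|p Cp]; last exact: v_cuts.
  by have := v_cube i; rewrite /= in_itv /= => /andP[].
(* A feasible point of objective above [B] may leave the cube, but the minimum found there is at
   most [B]. *)
move=> _ [theta K_theta <-]; have [|/ltW] := leP (\sum_i theta i) B.
  exact: v_le.
exact: le_trans.
Qed.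

(** * Validity of the cuts *)

Section PCuts.
Context (R : realType) (n : nat) (d : measure_display) (T : measurableType d)
  (P : probability T R) (c : 'I_n.+1 -> 'I_n.+1 -> R) (Q : R)
  (xi : 'I_n -> {RV P >-> R}) (M : set nat).
Hypotheses (c_ge0 : forall i j, i != j -> 0 <= c i j) (Q_gt0 : 0 < Q)
  (xi_ge0 : forall i t, 0 <= xi i t)
  (xi_mean : forall i, P.-integrable setT (EFin \o xi i))
  (xi_mono : monotonicity_property Q xi).

Lemma solution_uniq x Rs :
  first_stage_solution Q xi M x Rs -> uniq (flatten Rs).
Proof. by move=> [_ _ perm_Rs _ _]; rewrite (perm_uniq perm_Rs) enum_uniq. Qed.

Lemma solution_mem x Rs (i : 'I_n) :
  first_stage_solution Q xi M x Rs -> i \in flatten Rs.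
Proof. by move=> [_ _ perm_Rs _ _]; rewrite (perm_mem perm_Rs) mem_enum. Qed.

Lemma solution_mono x Rs (r : seq 'I_n) :
  first_stage_solution Q xi M x Rs -> r \in Rs ->
  monotonicity_condition Q xi [set i in r]%SET.
Proof.
move=> sol r_Rs; have uniq_r := flatten_uniq_mem (solution_uniq sol) r_Rs.
case: sol => [_ _ _ mean_Rs _]; apply: xi_mono.
rewrite (eq_bigl [in r]) => [|i]; last by rewrite inE.
by rewrite -big_uniq //; exact: mean_Rs.
Qed.

Lemma cuts_tight x Rs (theta : 'I_n -> R) :
    first_stage_solution Q xi M x Rs -> cut_feasible c Q xi [set` Rs] x theta ->
  total_recourse c Q xi Rs <= \sum_i theta i.
Proof.
move=> sol [theta_ge0 cuts]; have uniq_Rs := solution_uniq sol.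
case: sol => [_ _ perm_Rs _ xE].
rewrite -big_enum -(perm_big _ perm_Rs) /= big_flatten /total_recourse.
rewrite big_seq [leRHS]big_seq; apply: ler_sum => p p_Rs.
have := cuts p p_Rs; rewrite /p_cut -big_uniq ?(flatten_uniq_mem uniq_Rs) //.
(* On a route of the solution itself the cut factor is at least 1, so the cut dominates the
   nonnegative recourse of that route. *)
apply: le_trans; rewrite ler_peMr ?recourse_ge0 // lerDr subr_ge0 ler_nat.
rewrite path_valueE; under eq_bigr do rewrite xE.
by rewrite -path_valueE path_value_full.
Qed.

Definition best_orientation (r : seq 'I_n) : seq 'I_n :=
  if oriented_recourse c Q xi r <= oriented_recourse c Q xi (rev r)
  then r else rev r.

Lemma best_orientationP (r : seq 'I_n) :
  [/\ perm_eq (best_orientation r) r,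
      oriented_recourse c Q xi (best_orientation r) = recourse c Q xi r &
      best_orientation r = r \/ best_orientation r = rev r].
Proof.
rewrite /best_orientation /recourse; case: leP => le_or; split; auto.
by rewrite perm_rev.
Qed.

(** In a solution exactly one route contains [i], so the sum has one term; writing a sum avoids
    selecting that route. *)
Definition recourse_share (Rs : seq (seq 'I_n)) (i : 'I_n) : R :=
  \sum_(r <- Rs | i \in r)
    let r' := best_orientation r in detour_cost c Q xi (take (index i r') r') i.

Lemma sum_recourse_share (Rs : seq (seq 'I_n)) :
  uniq (flatten Rs) -> \sum_i recourse_share Rs i = total_recourse c Q xi Rs.
Proof.
move=> uniq_Rs; rewrite /recourse_share (exchange_big_dep predT) //=.
rewrite /total_recourse big_seq [RHS]big_seq; apply: eq_bigr => r r_Rs.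
have [perm_r <- _] := best_orientationP r.
have uniq_r := flatten_uniq_mem uniq_Rs r_Rs.
rewrite oriented_recourseE ?(perm_uniq perm_r) // (perm_big _ perm_r) /=.
by rewrite big_uniq.
Qed.

Lemma recourse_le_share x Rs (p r : seq 'I_n) :
    first_stage_solution Q xi M x Rs -> r \in Rs -> uniq p ->
    infix p r || infix p (rev r) ->
  recourse c Q xi p <= \sum_(i in p) recourse_share Rs i.
Proof.
move=> sol r_Rs uniq_p p_r; have [perm_r _ best_r] := best_orientationP r.
have uniq_r := flatten_uniq_mem (solution_uniq sol) r_Rs.
set r' := best_orientation r in perm_r best_r *.
(* [q] is [p] or its reversal, whichever follows the cheaper orientation [r']; the recourse does not
   distinguish them. *)
have [q [perm_q eq_q q_r']] : exists q,
    [/\ perm_eq q p, recourse c Q xi q = recourse c Q xi p & infix q r'].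
  have [p_r'|p_r'] := boolP (infix p r'); first by exists p.
  exists (rev p); split; rewrite ?perm_rev ?recourse_rev // infix_revLR.
  by case: best_r p_r' p_r => ->; rewrite ?revK => /negbTE ->; rewrite ?orbF.
rewrite -eq_q -big_uniq // -(perm_big _ perm_q) /=.
apply: (@le_trans _ _ (oriented_recourse c Q xi q)); first by rewrite ge_min lexx.
have mono_r' : monotonicity_condition Q xi [set i in r']%SET.
  rewrite (_ : finset _ = [set i in r]%SET); first exact: solution_mono sol r_Rs.
  by apply/setP => i; rewrite !inE (perm_mem perm_r).
apply: (le_trans (oriented_recourse_infix _ _ _ _ mono_r' _ q_r')) => //.
  by rewrite (perm_uniq perm_r).
rewrite big_seq [leRHS]big_seq; apply: ler_sum => i i_q.
have i_r : i \in r by rewrite -(perm_mem perm_r) (mem_infix q_r').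
(* Keeping only the term of [r] suffices, the others being nonnegative. *)
rewrite /recourse_share (big_rem r) //= i_r lerDl sumr_ge0 // => s _.
exact: detour_cost_ge0.
Qed.

Lemma recourse_share_feasible x Rs (C : set (seq 'I_n)) :
    first_stage_solution Q xi M x Rs ->
    (forall p, C p ->
       exists y Rs', first_stage_solution Q xi M y Rs' /\ p \in Rs') ->
  cut_feasible c Q xi C x (recourse_share Rs).
Proof.
move=> sol C_routes.
have share_ge0 i : 0 <= recourse_share Rs i.
  by apply: sumr_ge0 => r _; exact: detour_cost_ge0.
split=> // p /C_routes[y [Rs' [sol' p_Rs']]].
have uniq_p := flatten_uniq_mem (solution_uniq sol') p_Rs'.
have p_neq0 : p != [::] by case: sol' => _ /(_ p p_Rs').
have xE : path_value x p = path_value (traversals Rs) p.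
  by rewrite !path_valueE; apply: eq_bigr => e _; case: sol => _ _ _ _ ->.
have rec_ge0 : 0 <= recourse c Q xi p by exact: recourse_ge0.
rewrite /p_cut xE.
have [full|partial] := leqP (size p).-1 (path_value (traversals Rs) p); last first.
  (* By integrality a missing edge makes the factor at most 0, and nonnegativity of the shares gives
     the cut. *)
  apply: (@le_trans _ _ 0); last exact: sumr_ge0.
  by rewrite mulr_ge0_le0 // addrAC natr1 subr_le0 ler_nat.
have [r r_Rs p_r] := path_value_subpath (solution_uniq sol)
  (fun i => solution_mem i sol) uniq_p p_neq0 full.
have le_path : (path_value (traversals Rs) p <= (size p).-1)%N.
  rewrite path_valueE -size_steps -sum1_size; apply: leq_sum => e _.
  by rewrite traversals_le1 // (solution_uniq sol).
have -> : path_value (traversals Rs) p = (size p).-1.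
  by apply/eqP; rewrite eqn_leq le_path.
by rewrite subrr add0r mulr1; exact: recourse_le_share sol r_Rs uniq_p p_r.
Qed.

End PCuts.

Theorem proposition11 (R : realType) (n : nat)
    (d : measure_display) (T : measurableType d) (P : probability T R)
    (c : 'I_n.+1 -> 'I_n.+1 -> R) (Q : R) (xi : 'I_n -> {RV P >-> R})
    (M : set nat)
    (c_sym : forall i j, c i j = c j i)
    (c_ge0 : forall i j, i != j -> 0 <= c i j)
    (Q_gt0 : 0 < Q)
    (xi_ge0 : forall i t, 0 <= xi i t)
    (xi_mean : forall i, P.-integrable setT (EFin \o xi i))
    (xi_indep : independent_demands xi)
    (xi_mono : monotonicity_property Q xi)
    (xnu : 'I_n.+1 -> 'I_n.+1 -> nat) (Rnu : seq (seq 'I_n))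
    (xnu_sol : first_stage_solution Q xi M xnu Rnu) :
  (forall theta : 'I_n -> R,
     cut_feasible c Q xi [set` Rnu] xnu theta ->
     \sum_i theta i >= total_recourse c Q xi Rnu)
  /\
  (forall (xlam : 'I_n.+1 -> 'I_n.+1 -> nat) (Rlam : seq (seq 'I_n)),
     first_stage_solution Q xi M xlam Rlam ->
   forall C : set (seq 'I_n),
     (forall p, C p ->
        exists x Rs, first_stage_solution Q xi M x Rs /\ p \in Rs) ->
   exists v : R,
     is_minimum [set \sum_i theta i | theta in cut_feasible c Q xi C xlam] v
     /\ v <= total_recourse c Q xi Rlam).
Proof.
split=> [theta|xlam Rlam sol C C_routes]; first exact: cuts_tight xnu_sol.
(* The bound becomes the objective value at the shares, the feasible point from which the minimum is
   obtained. *)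
rewrite -(sum_recourse_share c Q xi (solution_uniq sol)).
apply: (covering_minimum (J := fun p : seq 'I_n => [in p])).
exact: recourse_share_feasible C_routes.
Qed.
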